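(* Let $A$ be a subdirectly irreducible $\mathbb{Z}[t,t^{-1}]$-module such that $\varphi\colon a\mapsto(1-t)\cdot a$ is a non-injective endomorphism of $A$. Let $C$ be a subset of a transversal to $\varphi(A)$ in $A$ such that $C\cup\varphi(A)$ generates $A$. Denote by $\mathcal{SIQ}(A,t,C)$ the set $A\cup(\varphi(A)\times C)$ (disjoint union) equipped with the operation $\ast$ given by \begin{align*} a\ast b&=\varphi(a)+t\cdot b, && a,b\in A,\\ (a,i)\ast(b,j)&=(\varphi(a+i-j)+t\cdot b,\;j), && a,b\in\varphi(A),\ i,j\in C,\\ (a,i)\ast b&=a+t\cdot b+i, && a\in\varphi(A),\ i\in C,\ b\in A,\\ a\ast(b,j)&=(\varphi(\varphi(a)-j)+t\cdot b,\;j), && a\in A,\ b\in\varphi(A),\ j\in C, \end{align*} and with the operation $\backslash$ defined as the left division with respect to $\ast$. Then the algebra $\mathcal{SIQ}(A,t,C)$ is a subdirectly irreducible quasi-reductive medial quandle. Conversely, every subdirectly irreducible quasi-reductive medial quandle is isomorphic to $\mathcal{SIQ}(A,t,C)$ for some subdirectly irreducible $\mathbb{Z}[t,t^{-1}]$-module $A$ such that $\varphi\colon a\mapsto(1-t)\cdot a$ is a non-injective endomorphism of $A$, and some subset $C$ of a transversal to $\varphi(A)$ in $A$ such that $C\cup\varphi(A)$ generates $A$.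
   Context: A quandle is an algebra $(Q,\ast,\backslash)$ with two binary operations such that for all $x,y,z\in Q$: $x\ast x=x$; $x\ast(y\ast z)=(x\ast y)\ast(x\ast z)$; $x\backslash(x\ast y)=y=x\ast(x\backslash y)$. It is medial if for all $x,y,u,v$: $(x\ast y)\ast(u\ast v)=(x\ast u)\ast(y\ast v)$, $(x\backslash y)\backslash(u\backslash v)=(x\backslash u)\backslash(y\backslash v)$ and $(x\backslash y)\ast(u\backslash v)=(x\ast u)\backslash(y\ast v)$. Left division: $x\backslash y$ is the unique $z$ with $x\ast z=y$. Let $L_a\colon x\mapsto a\ast x$. The orbits of $Q$ are the orbits of the permutation group generated by all $L_a$, $a\in Q$. A quandle $Q$ is quasi-reductive if there exist two different elements $a,b\in Q$ lying in the same orbit such that $L_a=L_b$. An algebra is subdirectly irreducible if the intersection of all its non-trivial congruences (congruences different from equality) is non-trivial; for a module this means that it has a smallest non-zero submodule. A transversal to $\varphi(A)$ in $A$ is a set containing exactly one element of each coset of $\varphi(A)$ in $A$ (so a subset $C$ of a transversal is a set, possibly empty, whose distinct elements lie in distinct cosets; it may contain an element of $\varphi(A)$). *)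

(* Defs.v *)
From HB Require Import structures.
From mathcomp Require Import all_boot all_order all_algebra.
From mathcomp Require Import boolp classical_sets.

Set Implicit Arguments.
Unset Strict Implicit.
Unset Printing Implicit Defensive.

Import GRing.Theory.
Local Open Scope classical_set_scope.
Local Open Scope ring_scope.

(* The ring Z[t, t^-1] of Laurent polynomials, realised as the subring of the  *)
(* fraction field of Z[X] whose elements are the fractions p / X^n.            *)

Definition is_laurent : {pred {fraction {poly int}}} :=
  fun x => `[< exists (p : {poly int}) (n : nat),
                 x = FracField.tofrac p / FracField.tofrac 'X ^+ n >].

Lemma is_laurent_subring_closed : subring_closed is_laurent.
Proof.
have X0 : FracField.tofrac 'X != 0 :> {fraction {poly int}}.
  by rewrite tofrac_eq0 polyX_eq0.
split=> [|x y|x y].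
- by apply/asboolP; exists 1, 0; rewrite expr0 divr1 tofrac1.
- move=> /asboolP[p [n ->]] /asboolP[q [m ->]]; apply/asboolP.
  exists (p * 'X ^+ m - q * 'X ^+ n), (n + m)%N.
  rewrite tofracB !tofracM !tofracXn exprD mulrBl.
  rewrite -mulf_div divff ?expf_neq0 // mulr1; congr (_ - _).
  by rewrite (mulrC (FracField.tofrac 'X ^+ n)) -mulf_div divff ?expf_neq0 // mulr1.
- move=> /asboolP[p [n ->]] /asboolP[q [m ->]]; apply/asboolP.
  by exists (p * q), (n + m)%N; rewrite tofracM exprD mulf_div.
Qed.

HB.instance Definition _ :=
  GRing.isSubringClosed.Build _ is_laurent is_laurent_subring_closed.

Record laurent := Laurent {
  laurent_val : {fraction {poly int}};
  laurent_valP : laurent_val \in is_laurent }.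

HB.instance Definition _ := [isSub for laurent_val].
HB.instance Definition _ := [Choice of laurent by <:].
HB.instance Definition _ := [SubChoice_isSubComNzRing of laurent by <:].

Lemma laurent_t_subproof : FracField.tofrac 'X \in is_laurent.
Proof. by apply/asboolP; exists 'X, 0; rewrite expr0 divr1. Qed.

Definition laurent_t : laurent := Laurent laurent_t_subproof.

Section Module.
Variable A : lmodType laurent.
Implicit Types (M G T C : set A).

Definition submodule M : Prop := submod_closed [in M].

Definition module_subdirectly_irreducible : Prop :=
  exists M, [/\ submodule M, M <> [set 0] &
    forall N : set A, submodule N -> N <> [set 0] -> M `<=` N].

Definition generates_module G : Prop := smallest submodule G = [set: A].

Definition phi (a : A) : A := (1 - laurent_t) *: a.

Definition is_transversal M T : Prop :=
  forall a : A, exists! x : A, T x /\ M (x - a).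

Definition sub_transversal M C : Prop :=
  exists2 T : set A, is_transversal M T & C `<=` T.

End Module.

Record algebra2 := Algebra2 {
  carrier :> Type;
  qmul : carrier -> carrier -> carrier;
  qldiv : carrier -> carrier -> carrier }.

Notation "x ** y" := (qmul x y) (at level 40, left associativity).
Notation "x \\ y" := (qldiv x y) (at level 40, left associativity).

Section Quandle.
Variable Q : algebra2.
Implicit Types (x y z u v : Q) (R : Q -> Q -> Prop).

Definition quandle : Prop :=
  [/\ forall x, x ** x = x,
      forall x y z, x ** (y ** z) = (x ** y) ** (x ** z),
      forall x y, x \\ (x ** y) = y &
      forall x y, x ** (x \\ y) = y].

Definition medial : Prop :=
  [/\ forall x y u v, (x ** y) ** (u ** v) = (x ** u) ** (y ** v),
      forall x y u v, (x \\ y) \\ (u \\ v) = (x \\ u) \\ (y \\ v) &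
      forall x y u v, (x \\ y) ** (u \\ v) = (x ** u) \\ (y ** v)].

Definition ltrans x : Q -> Q := fun y => x ** y.

(* The permutation group generated by all left translations (these are         *)
(* bijective when Q is a quandle).                                             *)
Inductive lmlt_group : (Q -> Q) -> Prop :=
| lmlt_ltrans x : lmlt_group (ltrans x)
| lmlt_id : lmlt_group id
| lmlt_comp f g : lmlt_group f -> lmlt_group g -> lmlt_group (f \o g)
| lmlt_inv f g : lmlt_group f -> cancel f g -> cancel g f -> lmlt_group g.

Definition same_orbit x y : Prop := exists2 f, lmlt_group f & f x = y.

Definition quasi_reductive : Prop :=
  exists x y, [/\ x <> y, same_orbit x y & ltrans x = ltrans y].

Definition congruence R : Prop :=
  [/\ forall x, R x x,
      forall x y, R x y -> R y x,
      forall x y z, R x y -> R y z -> R x z,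
      forall x y u v, R x y -> R u v -> R (x ** u) (y ** v) &
      forall x y u v, R x y -> R u v -> R (x \\ u) (y \\ v)].

Definition nontrivial_congruence R : Prop := congruence R /\ R <> eq.

Definition subdirectly_irreducible : Prop :=
  (fun x y => forall R, nontrivial_congruence R -> R x y) <> eq.

End Quandle.

Definition isomorphic (Q Q' : algebra2) : Prop :=
  exists f : Q -> Q',
    [/\ bijective f,
        forall x y, f (x ** y) = f x ** f y &
        forall x y, f (x \\ y) = f x \\ f y].

(* x \ y is a z with op x z = y; the default value y is only returned when no  *)
(* such z exists, which the quandle law x ** (x \\ y) = y excludes.            *)
Definition left_division (T : choiceType) (op : T -> T -> T) (x y : T) : T :=
  xget y [set z | op x z = y].

Section SIQ.
Variables (A : lmodType laurent) (C : set A).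
Local Notation t := laurent_t.
Local Notation phi := (@phi A).

Lemma siq_range_subproof (x : A) (b : range phi) :
  phi x + t *: val b \in range phi.
Proof.
case: b => b /= /set_mem [c _ <-]; apply/mem_set; exists (x + t *: c) => //.
by rewrite /Defs.phi scalerDr !scalerA mulrC.
Qed.

Definition siq_range (x : A) (b : range phi) : range phi :=
  exist _ (phi x + t *: val b) (siq_range_subproof x b).

Definition siq_carrier : choiceType := (A + range phi * C)%type.

Definition siq_mul (x y : siq_carrier) : siq_carrier :=
  match x, y with
  | inl a, inl b => inl (phi a + t *: b)
  | inr (a, i), inr (b, j) => inr (siq_range (val a + val i - val j) b, j)
  | inr (a, i), inl b => inl (val a + t *: b + val i)
  | inl a, inr (b, j) => inr (siq_range (phi a - val j) b, j)
  end.

Definition SIQ : algebra2 := Algebra2 siq_mul (left_division siq_mul).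

End SIQ.

(* Main.v *)
(* Every element of SIQ(A,t,C) acts on it through its value in A: with         *)
(* siq_val a = phi a and siq_val (a, i) = a + i, and with A translating the    *)
(* orbit A by w and the orbits phi(A) x {i} by phi w, one has                  *)
(*   x * y = y translated by siq_val x - siq_val y.                            *)
(* Conversely, A is recovered as the abelian group of displacements generated  *)
(* by the L_x L_y^-1, where t is conjugation by any L_e; then                  *)
(* phi d = L_(d e) L_e^-1, so quasi-reductivity says that K = ker phi is not   *)
(* 0. For an orbit o, identifying the points of o that differ by K is a        *)
(* congruence; two such congruences meet trivially, so subdirect               *)
(* irreducibility leaves exactly one orbit moved by K. On this orbit A is      *)
(* regular. Off it, L is injective, because identifying the points off it with *)
(* equal L is a congruence which must be trivial, so each other orbit is       *)
(* mapped by x |-> L_x L_e^-1 bijectively onto a coset of phi(A), and distinct *)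
(* orbits onto distinct cosets.                                                *)
From HB Require Import structures.
Require Import Defs.
From mathcomp Require Import all_boot all_order all_algebra.
From mathcomp Require Import boolp classical_sets.

Set Implicit Arguments.
Unset Strict Implicit.
Unset Printing Implicit Defensive.

Import GRing.Theory.
Local Open Scope classical_set_scope.
Local Open Scope ring_scope.

(** Both directions rest on one normal form: a product is its right factor translated by a
    difference of values in A ([siq_mulE] in the model, [mul_transv] in Q). In the model the quandle
    and medial laws thus become identities in A. Since C and phi(A) generate A, all translations lie
    in the group generated by the L_x ([lmlt_siq_shift]), so 0 and a non-zero k in ker phi lie in
    one orbit and have the same L. For a non-trivial congruence, the differences that it identifies
    throughout A form a submodule; this is non-zero, hence contains the least one
    ([siq_subdirectly_irreducible]).

    Conversely, [phi_transv] computes phi on displacements. The orbit moved by ker phi is regular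
    ([stab_e]), and values separate the points off it ([transv_off_inj]), which makes [to_siq]
    injective. Each submodule induces a congruence, so A inherits a least submodule
    ([disp_module_subdirectly_irreducible]). *)

Local Notation X := (FracField.tofrac ('X : {poly int})).

(** * Laurent polynomials and submodules *)

Lemma tofracX_neq0 n : X ^+ n != 0.
Proof. by rewrite expf_neq0 // tofrac_eq0 polyX_eq0. Qed.

Lemma laurent_inj : injective laurent_val.
Proof. exact: val_inj. Qed.

Lemma laurent_tV_subproof : X^-1 \in is_laurent.
Proof. by apply/asboolP; exists 1, 1%N; rewrite expr1 tofrac1 mul1r. Qed.

Definition laurent_tV : laurent := Laurent laurent_tV_subproof.

Local Notation t := laurent_t.
Local Notation tV := laurent_tV.

Lemma laurent_tK : t * tV = 1.
Proof. by apply: laurent_inj; rewrite /= mulfV // -(expr1 X) tofracX_neq0. Qed.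

Lemma laurent_tVK : tV * t = 1.
Proof. by rewrite mulrC laurent_tK. Qed.

Lemma laurent_poly_subproof (p : {poly int}) : FracField.tofrac p \in is_laurent.
Proof. by apply/asboolP; exists p, 0%N; rewrite expr0 divr1. Qed.

Definition laurent_poly p : laurent := Laurent (laurent_poly_subproof p).

Lemma laurent_poly_MXaddC p c :
  laurent_poly (p * 'X + c%:P) = laurent_poly p * t + c%:~R.
Proof.
apply: laurent_inj; rewrite /= tofracD tofracM; congr (_ + _).
have -> : c%:P = c%:~R by rewrite -[in LHS](intz c) rmorph_int.
by rewrite rmorph_int [RHS](rmorph_int (val : laurent -> _)).
Qed.

Lemma laurent_polyP a : exists p n, a = tV ^+ n * laurent_poly p.
Proof.
case: a => x xL; have /asboolP[p [n xE]] := xL.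
exists p, n; apply: laurent_inj; rewrite /= xE mulrC -exprVn; congr (_ * _).
by rewrite [RHS](rmorphXn (val : laurent -> _)).
Qed.

Section LaurentModule.
Variable A : lmodType laurent.
Implicit Types (N : set A) (a b : A).

Lemma laurent_scaleK : cancel ( *:%R t : A -> A) ( *:%R tV).
Proof. by move=> a; rewrite scalerA laurent_tVK scale1r. Qed.

Lemma laurent_scaleVK : cancel ( *:%R tV : A -> A) ( *:%R t).
Proof. by move=> a; rewrite scalerA laurent_tK scale1r. Qed.

(** A scalar is t^-n p with p in Z[t]; Horner induction on p reduces its action to that of t and of
    integers, and an integer acts by repeated addition and negation. *)
Lemma submoduleI N : N 0 -> (forall a b, N a -> N b -> N (a + b)) ->
  (forall a, N a -> N (- a)) -> (forall a, N a -> N (t *: a)) ->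
  (forall a, N a -> N (tV *: a)) -> submodule N.
Proof.
move=> N0 ND NN Nt NtV; split; first exact/mem_set.
move=> a u v /set_mem Nu /set_mem Nv; apply/mem_set; apply: (ND) => //.
have [p [n ->]] := laurent_polyP a; rewrite -scalerA.
elim: n => [|n IHn]; last by rewrite exprS -scalerA; apply: (NtV).
rewrite scale1r; elim/poly_ind: p u Nu {Nv v a} => [|p c IHp] u Nu.
  have -> : laurent_poly 0 = 0 by apply: laurent_inj; rewrite /= tofrac0.
  by rewrite scale0r.
rewrite laurent_poly_MXaddC scalerDl -scalerA; apply: (ND); first exact/IHp/Nt.
have Nn k : N (k%:R *: u).
  by elim: k => [|k IHk]; rewrite ?scale0r // mulrS scalerDl scale1r; apply: (ND).
by case: c => k; rewrite ?NegzE ?mulrNz ?scaleNr; [|apply: NN]; apply: Nn.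
Qed.

Lemma submoduleP N : submodule N ->
  [/\ N 0, forall a b, N a -> N b -> N (a + b), forall a, N a -> N (- a) &
      forall c a, N a -> N (c *: a)].
Proof.
move=> [/set_mem N0 Nlin].
have NZ c a : N a -> N (c *: a).
  by move=> /mem_set Na; rewrite -[_ *: _]addr0; apply/set_mem/Nlin => //; apply/mem_set.
split=> // [a b /mem_set Na /mem_set Nb|a].
  by rewrite -[a]scale1r; apply/set_mem/Nlin.
by rewrite -scaleN1r; apply: NZ.
Qed.

Lemma generates_moduleW G N :
  generates_module G -> G `<=` N -> submodule N -> forall a, N a.
Proof. by move=> gen GN sN a; have : [set: A] a by []; rewrite -gen; apply. Qed.

Lemma phiE a : phi a = a - t *: a.
Proof. by rewrite /phi scalerBl scale1r. Qed.

Lemma phi_scale c a : phi (c *: a) = c *: phi a.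
Proof. by rewrite /phi !scalerA mulrC. Qed.

Lemma phiD a b : phi (a + b) = phi a + phi b.
Proof. exact: scalerDr. Qed.

Lemma phiN a : phi (- a) = - phi a.
Proof. exact: scalerN. Qed.

Lemma phiB a b : phi (a - b) = phi a - phi b.
Proof. exact: scalerBr. Qed.

Lemma phi_addt a : phi a + t *: a = a.
Proof. by rewrite phiE subrK. Qed.

Lemma phi0 : phi 0 = 0 :> A.
Proof. exact: scaler0. Qed.

End LaurentModule.

(** * Generalities on medial quandles and congruences *)

Lemma medial_quandle (Q : algebra2) : quandle Q ->
  (forall x y u v : Q, (x ** y) ** (u ** v) = (x ** u) ** (y ** v)) -> medial Q.
Proof.
move=> [_ _ mulK divK] med.
have med3 (x y u v : Q) : (x \\ y) ** (u \\ v) = (x ** u) \\ (y ** v).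
  by rewrite -[LHS](mulK (x ** u)) med !divK.
by split=> // x y u v; rewrite -[RHS](mulK (x \\ y)) med3 !divK.
Qed.

(** The equivalence, rather than one implication, is what carries the induction through inverses. *)
Lemma congruence_lmlt (Q : algebra2) (R : Q -> Q -> Prop) (f : Q -> Q) :
  quandle Q -> congruence R -> lmlt_group f ->
  forall x y, R x y <-> R (f x) (f y).
Proof.
move=> [_ _ mulK _] [Rr _ _ Rm Rd].
elim=> [z x y|//|g h _ IHg _ IHh x y|g h _ IHg _ hK x y].
- by split=> [|/(Rd z z _ _ (Rr z))]; [exact: Rm|rewrite /ltrans !mulK].
- by rewrite IHh IHg.
- by rewrite [X in _ <-> X]IHg !hK.
Qed.

(** * The quandle SIQ(A,t,C) *)

Section SIQTheory.
Variables (A : lmodType laurent) (C : set A).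
Local Notation Q := (SIQ C).
Implicit Types (x y z : Q) (w v : A).

Definition siq_val x : A :=
  match x with inl a => phi a | inr (a, i) => val a + val i end.

Lemma siq_shift_subproof (b : range (@phi A)) w :
  val b + phi w \in range (@phi A).
Proof.
case: b => b /= /set_mem [c _ <-]; apply/mem_set; exists (c + w) => //.
exact: phiD.
Qed.

Definition siq_shift w x : Q :=
  match x with
  | inl a => inl (a + w)
  | inr (a, i) => inr (exist _ (val a + phi w) (siq_shift_subproof a w), i)
  end.

Lemma siq_shift0 x : siq_shift 0 x = x.
Proof.
case: x => [a|[a i]] /=; first by rewrite addr0.
by congr (inr (_, i)); apply: val_inj; rewrite /= phi0 addr0.
Qed.

Lemma siq_shiftD w v x : siq_shift w (siq_shift v x) = siq_shift (v + w) x.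
Proof.
case: x => [a|[a i]] /=; first by rewrite addrA.
by congr (inr (_, i)); apply: val_inj; rewrite /= phiD addrA.
Qed.

Lemma siq_shiftK w : cancel (siq_shift w) (siq_shift (- w)).
Proof. by move=> x; rewrite siq_shiftD subrr siq_shift0. Qed.

Lemma siq_shiftVK w : cancel (siq_shift (- w)) (siq_shift w).
Proof. by move=> x; rewrite siq_shiftD addNr siq_shift0. Qed.

Lemma siq_val_shift w x : siq_val (siq_shift w x) = siq_val x + phi w.
Proof. by case: x => [a|[a i]] /=; rewrite ?phiD // addrAC. Qed.

Lemma siq_mulE x y : x ** y = siq_shift (siq_val x - siq_val y) y.
Proof.
have affE a b : b + (a - phi b) = a + t *: b :> A.
  by rewrite addrCA phiE opprB [b + _]addrC subrK.
case: x y => [a|[a i]] [b|[b j]] /=.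
- by rewrite affE.
- congr (inr (_, j)); apply: val_inj => /=.
  by rewrite -affE -phiB; congr (_ + phi _); rewrite opprD addrA addrAC.
- by rewrite affE addrAC.
- congr (inr (_, j)); apply: val_inj => /=.
  rewrite -affE -phiB; congr (_ + phi _).
  by rewrite opprD !addrA addrAC.
Qed.

Lemma siq_val_mul x y :
  siq_val (x ** y) = phi (siq_val x) + t *: siq_val y.
Proof.
by rewrite siq_mulE siq_val_shift phiB addrCA -{1}[siq_val y]phi_addt addrAC subrr add0r.
Qed.

Lemma siq_mul_medial (x y u v : Q) : (x ** y) ** (u ** v) = (x ** u) ** (y ** v).
Proof.
(* Both sides translate [v] by an amount in which the two middle arguments enter only through the
   sum of their values. *)
suff E (a b : Q) : (x ** a) ** (b ** v) = siq_shift (phi (siq_val x)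
    + t *: (siq_val a + siq_val b) - siq_val v - t *: siq_val v) v.
  by rewrite !E [siq_val y + _]addrC.
rewrite [LHS]siq_mulE !siq_val_mul siq_mulE siq_shiftD; congr siq_shift.
rewrite -{1}[siq_val b]phi_addt scalerDr opprD !addrA.
by rewrite [LHS](ACl (1*6*4*5*2*3*7)) /= subrr add0r.
Qed.

Lemma siq_mul_inj x : injective (qmul x).
Proof.
move=> y z E; have vE : siq_val y = siq_val z.
  have := congr1 siq_val E; rewrite !siq_val_mul => /addrI.
  by move/(can_inj (@laurent_scaleK A)).
by move: E; rewrite !siq_mulE vE => /(can_inj (@siq_shiftK _)).
Qed.

Lemma siq_divP x y : x ** (x \\ y) = y.
Proof.
apply: (@xgetPex _ y [set z | siq_mul x z = y]).
(* Translating y by w adds w - phi w = t w to the total translation, so t w must cancel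
   [siq_val x - siq_val y]. *)
exists (siq_shift (tV *: (siq_val y - siq_val x)) y) => /=.
change (x ** siq_shift (tV *: (siq_val y - siq_val x)) y = y).
rewrite siq_mulE siq_shiftD -[RHS]siq_shift0; congr siq_shift.
rewrite siq_val_shift phiE laurent_scaleVK !(opprD, opprK) !addrA.
by rewrite [LHS](AC 6 ((1*4)*(2*6)*(5*3))) /= !subrr !addr0.
Qed.

Lemma siq_quandle : quandle Q.
Proof.
have idem x : x ** x = x by rewrite siq_mulE subrr siq_shift0.
split=> // [x y z|x y|x y]; last exact: siq_divP.
- by rewrite -{1}[x]idem siq_mul_medial.
- exact/siq_mul_inj/siq_divP.
Qed.

Lemma siq_medial : medial Q.
Proof. exact: medial_quandle siq_quandle siq_mul_medial. Qed.

Lemma siq_shift_mul w x y : x ** siq_shift w y = siq_shift (t *: w) (x ** y).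
Proof.
rewrite !siq_mulE !siq_shiftD siq_val_shift; congr siq_shift.
rewrite phiE !(opprD, opprK) !addrA.
by rewrite [LHS](ACl (1*4*2*3*5)) /= subrr add0r.
Qed.

(** The w whose translation is in the group form a submodule, because conjugation by an L_o
    multiplies w by t ([siq_shift_mul]). It contains C and phi(A), because translation by
    [siq_val x] is L_x L_o^-1 for o = [inl 0]. *)
Lemma lmlt_siq_shift : generates_module (C `|` range (@phi A)) ->
  forall w, @lmlt_group Q (siq_shift w).
Proof.
move=> gen; have [_ _ mulK divK] := siq_quandle.
have Linv x : @lmlt_group Q (qldiv x).
  by apply: (@lmlt_inv _ (ltrans x)) => //; apply: lmlt_ltrans.
have valL x : @lmlt_group Q (siq_shift (siq_val x)).
  have -> : siq_shift (siq_val x) = ltrans x \o qldiv (inl 0 : Q).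
    apply/funext => z; rewrite -{1}[z](divK (inl 0)) /comp /ltrans !siq_mulE siq_shiftD.
    by congr siq_shift; rewrite /= phi0 sub0r addrC.
  by apply: lmlt_comp => //; apply: lmlt_ltrans.
apply: (generates_moduleW gen) => [w [Cw|[a _ <-]]|]; last 1 first.
- apply: submoduleI.
  + have -> : siq_shift 0 = id by apply/funext => x; apply: siq_shift0.
    exact: lmlt_id.
  + move=> v w Lv Lw; have -> : siq_shift (v + w) = siq_shift w \o siq_shift v.
      by apply/funext => x /=; rewrite siq_shiftD.
    exact: lmlt_comp.
  + move=> w Lw; apply: (lmlt_inv Lw); [exact: siq_shiftK|exact: siq_shiftVK].
  + move=> w Lw; pose o : Q := inl 0.
    have -> : siq_shift (t *: w) = ltrans o \o (siq_shift w \o qldiv o).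
      by apply/funext => x; rewrite /comp /ltrans siq_shift_mul divK.
    by apply: lmlt_comp; [exact: lmlt_ltrans|exact: lmlt_comp].
  + move=> w Lw; pose o : Q := inl 0.
    have -> : siq_shift (tV *: w) = qldiv o \o (siq_shift w \o ltrans o).
      apply/funext => x; rewrite /comp /ltrans.
      by rewrite -[w in RHS]laurent_scaleVK -siq_shift_mul mulK.
    by apply: lmlt_comp => //; apply: lmlt_comp => //; apply: lmlt_ltrans.
- have r0 : 0 \in range (@phi A) by apply/mem_set; exists 0 => //; apply: phi0.
  have := valL (inr (exist _ 0 r0, exist _ w (mem_set Cw))).
  by rewrite /= add0r.
- exact: valL (inl a).
Qed.

Hypothesis phi_ninj : ~ injective (@phi A).

Lemma phi_kernel_neq0 : exists2 k : A, k <> 0 & phi k = 0.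
Proof.
apply: contra_notP phi_ninj => noK a b E; apply/eqP; rewrite -subr_eq0.
apply/negP => /negP/eqP n0; apply: noK; exists (a - b) => //.
by rewrite phiB E subrr.
Qed.

Hypothesis gen : generates_module (C `|` range (@phi A)).

Lemma siq_quasi_reductive : quasi_reductive Q.
Proof.
have [k k0 phik0] := phi_kernel_neq0.
exists (inl 0), (inl k); split.
- by case=> /esym.
- by exists (siq_shift k); [exact: lmlt_siq_shift|rewrite /= add0r].
- by apply/funext => x; rewrite /ltrans !siq_mulE /= phik0 phi0.
Qed.

Hypothesis Csub : sub_transversal (range (@phi A)) C.

Lemma sub_transversal_inj a b : C a -> C b -> range (@phi A) (a - b) -> a = b.
Proof.
case: Csub => T tT CT /CT Ta /CT Tb rab; have [c [_ cU]] := tT b.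
rewrite -(cU a) // -(cU b) //; split=> //; exists 0 => //.
by rewrite phi0 subrr.
Qed.

Lemma siq_subdirectly_irreducible :
  module_subdirectly_irreducible A -> subdirectly_irreducible Q.
Proof.
have Qq := siq_quandle; have [_ _ mulK divK] := Qq.
case=> M [sM M0 Mmin].
have [M_0 _ _ _] := submoduleP sM.
have [m Mm m0] : exists2 m, M m & m <> 0.
  apply: contra_notP M0 => noM; apply/seteqP; split=> [a Ma|_ -> //].
  by apply: contra_notP noM => a0; exists a.
(* ker phi is a non-zero submodule, so it contains the least one. *)
have phim0 : phi m = 0.
  have [k k0 phik0] := phi_kernel_neq0.
  apply: (Mmin [set a | phi a = 0]) => //.
    apply: submoduleI => /=; first exact: phi0.
    - by move=> a b a_0 b_0; rewrite phiD a_0 b_0 addr0.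
    - by move=> a a_0; rewrite phiN a_0 oppr0.
    - by move=> a a_0; rewrite phi_scale a_0 scaler0.
    - by move=> a a_0; rewrite phi_scale a_0 scaler0.
  by move/seteqP => [/(_ k phik0)].
suff inR R : @nontrivial_congruence Q R -> R (inl 0) (inl m).
  move=> /(congr1 (fun f => f (inl 0) (inl m))) /= E.
  have : inl 0 = inl m :> Q by rewrite -E => R /inR.
  by case=> /esym.
move=> [cR Rneq]; have [Rr Rs Rt Rm Rd] := cR.
pose N : set A := [set a | forall b, R (inl b) (inl (b + a))].
have sN : submodule N.
  apply: submoduleI => [b|a c Na Nc b|a Na b|a Na b|a Na b].
  - by rewrite addr0; apply: Rr.
  - by apply: (Rt _ (inl (b + a))) => //; rewrite addrA.
  - by apply: Rs; have := Na (b - a); rewrite subrK.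
  - have := Rm _ _ _ _ (Rr (inl 0)) (Na (tV *: b)).
    by rewrite /= scalerDr laurent_scaleVK phi0 !add0r.
  - have E c : (inl 0 : Q) \\ inl (t *: c) = inl c.
      by rewrite -[RHS](mulK (inl 0)) /= phi0 add0r.
    have := Rd _ _ _ _ (Rr (inl 0)) (Na (t *: b)).
    by rewrite -{1}[a]laurent_scaleVK -scalerDr !E.
have shiftR w x y : R x y -> R (siq_shift w x) (siq_shift w y).
  exact: (congruence_lmlt Qq cR (lmlt_siq_shift gen w) x y).1.
have inlR a b : a <> b -> R (inl a) (inl b) -> N (b - a).
  by move=> ab Rab c; have /= := shiftR (c - a) _ _ Rab; rewrite addrCA subrr addr0 addrCA.
(* Translation by m fixes [inr (b, j)], as phi m = 0, but moves a; transitivity then relates a to a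
   + m. *)
have mixed a s : R (inl a) (inr s) -> exists2 c, c <> 0 & N c.
  case: s => b j Ras; exists m => //; have := shiftR m _ _ Ras.
  have -> : siq_shift m (inr (b, j)) = inr (b, j).
    by congr (inr (_, j)); apply: val_inj; rewrite /= phim0 addr0.
  move=> /Rs/(Rt _ _ _ Ras) /inlR; rewrite [a + m]addrC addrK; apply.
  by rewrite -[a in LHS]add0r => /addIr /esym.
suff [a a0 Na] : exists2 a, a <> 0 & N a.
  rewrite -[m]add0r; apply: (Mmin N) => //.
  by move/seteqP => [/(_ a Na)].
have [x [y [xy Rxy]]] : exists x y, x <> y /\ R x y.
  apply: contra_notP Rneq => noR; apply/funext => x; apply/funext => y.
  apply/propext; split=> [Rxy|<-]; last exact: Rr.
  by apply: contra_notP noR => xy; exists x, y.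
have [vE|vN] := pselect (siq_val x = siq_val y); last first.
  exists (siq_val y - siq_val x); first by move/eqP; rewrite subr_eq0 => /eqP/esym.
  (* On the chosen point of A, x acts with result b and y with result b + ([siq_val y] -
     [siq_val x]). *)
  move=> b; have := Rm _ _ _ _ Rxy (Rr (inl (tV *: (b - siq_val x)))).
  have E z a : (z : Q) ** inl a = inl (siq_val z + t *: a).
    by case: z => [c|[c i]] //=; rewrite addrAC.
  by rewrite !E laurent_scaleVK addrCA subrr addr0 addrCA.
move: x y xy Rxy vE => [a|[a i]] [b|[b j]] xy Rxy vE.
- exists (b - a); last by apply: inlR => // ab; rewrite ab in xy.
  by move/eqP; rewrite subr_eq0 => /eqP ab; rewrite ab in xy.
- exact: (mixed _ _ Rxy).
- exact: (mixed _ _ (Rs _ _ Rxy)).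
- case: xy; move: vE => /= vE.
  (* Equal values put i - j into phi(A), and C meets each coset at most once. *)
  have ij : i = j.
    apply: val_inj; apply: sub_transversal_inj; [exact/set_mem/valP..|].
    have -> : val i - val j = val b - val a.
      by apply/eqP; rewrite subr_eq addrAC -vE addrAC subrr add0r.
    case: (set_mem (valP a)) => c _ <-; case: (set_mem (valP b)) => d _ <-.
    by rewrite -phiB; exists (d - c).
  by rewrite ij in vE *; congr (inr (_, j)); apply: val_inj; apply: addIr vE.
Qed.

End SIQTheory.

(** * The Laurent module defined by an automorphism of an abelian group *)

Lemma laurent_polyM p q : laurent_poly (p * q) = laurent_poly p * laurent_poly q.
Proof. by apply: laurent_inj; rewrite /= tofracM. Qed.

Lemma laurent_polyD p q : laurent_poly (p + q) = laurent_poly p + laurent_poly q.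
Proof. by apply: laurent_inj; rewrite /= tofracD. Qed.

Lemma laurent_polyXn n : laurent_poly 'X^n = t ^+ n.
Proof.
by apply: laurent_inj; rewrite /= tofracXn [RHS](rmorphXn (val : laurent -> _)).
Qed.

Lemma laurent_poly_inj : injective laurent_poly.
Proof. by move=> p q /(congr1 laurent_val) /eqP /=; rewrite tofrac_eq => /eqP. Qed.

Lemma laurent_tXK n : t ^+ n * tV ^+ n = 1.
Proof. by rewrite -exprMn laurent_tK expr1n. Qed.

Section LaurentAction.
Variables (V : zmodType) (s sV : {additive V -> V}).
Hypotheses (sK : cancel s sV) (sVK : cancel sV s).
Implicit Types (u v : V) (p q : {poly int}) (a b : laurent).

(** This is p(s) applied to v. *)
Definition poly_act p v : V := \sum_(i < size p) iter i s v *~ p`_i.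

Lemma poly_act_wide n p v : (size p <= n)%N ->
  poly_act p v = \sum_(i < n) iter i s v *~ p`_i.
Proof.
move=> pn; rewrite /poly_act (big_ord_widen n (fun i => iter i s v *~ p`_i)) //.
rewrite big_mkcond /=; apply: eq_bigr => i _; case: ltnP => // ni.
by rewrite nth_default.
Qed.

Lemma iterD_additive n u v : iter n s (u + v) = iter n s u + iter n s v.
Proof. by elim: n => //= n ->; rewrite raddfD. Qed.

Lemma iterV_additive n u v : iter n sV (u + v) = iter n sV u + iter n sV v.
Proof. by elim: n => //= n ->; rewrite raddfD. Qed.

Lemma iterK n : cancel (iter n s) (iter n sV).
Proof. by elim: n => // n IHn v; rewrite iterSr /= sK IHn. Qed.

Lemma poly_actDr p u v : poly_act p (u + v) = poly_act p u + poly_act p v.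
Proof.
by rewrite -big_split; apply: eq_bigr => i _; rewrite iterD_additive mulrzDl.
Qed.

Lemma poly_actDl p q v : poly_act (p + q) v = poly_act p v + poly_act q v.
Proof.
have [hp hq] := (leq_maxl (size p) (size q), leq_maxr (size p) (size q)).
rewrite (poly_act_wide _ (size_polyD p q)) (poly_act_wide _ hp) (poly_act_wide _ hq).
by rewrite -big_split; apply: eq_bigr => i _; rewrite coefD mulrzDr.
Qed.

Lemma poly_actCM c q v : poly_act (c%:P * q) v = poly_act q v *~ c.
Proof.
have h : (size (c%:P * q)%R <= size q)%N by rewrite mul_polyC size_scale_leq.
rewrite (poly_act_wide _ h) /poly_act mulrz_suml; apply: eq_bigr => i _.
by rewrite coefCM mulrC mulrzA.
Qed.

Lemma poly_act1 v : poly_act 1 v = v.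
Proof. by rewrite /poly_act size_poly1 big_ord1 coef1. Qed.

Lemma poly_actMX p v : poly_act (p * 'X) v = poly_act p (s v).
Proof.
have h : (size (p * 'X)%R <= (size p).+1)%N.
  by rewrite (leq_trans (size_polyMleq _ _)) // size_polyX addn2.
rewrite (poly_act_wide _ h) big_ord_recl coefMX mulr0z add0r.
by apply: eq_bigr => i _; rewrite coefMX -iterSr.
Qed.

Lemma poly_act_s p v : poly_act p (s v) = s (poly_act p v).
Proof.
rewrite raddf_sum; apply: eq_bigr => i _.
by rewrite raddfMz -iterSr.
Qed.

Lemma poly_actM p q v : poly_act (p * q) v = poly_act p (poly_act q v).
Proof.
elim/poly_ind: p q v => [|p c IHp] q v.
  by rewrite mul0r /poly_act size_poly0 !big_ord0.
rewrite mulrDl -mulrA poly_actDl poly_actCM IHp poly_actDl -[c%:P in RHS]mulr1.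
rewrite poly_actCM poly_act1 poly_actMX; congr (poly_act p _ + _).
by rewrite mulrC poly_actMX poly_act_s.
Qed.

Lemma poly_actMXn n p v : poly_act (p * 'X^n) v = iter n s (poly_act p v).
Proof.
elim: n => [|n IHn] /=; first by rewrite expr0 mulr1.
by rewrite exprSr mulrA poly_actMX poly_act_s IHn.
Qed.

Lemma laurent_polyE a : exists pn : {poly int} * nat, a = tV ^+ pn.2 * laurent_poly pn.1.
Proof. by have [p [n ->]] := laurent_polyP a; exists (p, n). Qed.

Definition laurent_act a v : V :=
  let pn := projT1 (cid (laurent_polyE a)) in iter pn.2 sV (poly_act pn.1 v).

(** Independence of the fraction picked by [cid]: two fractions for the same scalar satisfy p X^m =
    q X^n already in Z[X], and s is invertible. *)
Lemma laurent_actE p n v :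
  laurent_act (tV ^+ n * laurent_poly p) v = iter n sV (poly_act p v).
Proof.
rewrite /laurent_act; case: cid => -[q m] /= E.
have {}E : p * 'X^m = q * 'X^n.
  apply: laurent_poly_inj; rewrite !laurent_polyM !laurent_polyXn.
  rewrite -[laurent_poly p]mul1r -(laurent_tXK n) -[_ * _ * laurent_poly p]mulrA E.
  by rewrite mulrC mulrCA [t ^+ m * _]mulrA laurent_tXK mul1r mulrC.
have := congr1 (fun r => poly_act r v) E; rewrite !poly_actMXn => {}E.
rewrite -[poly_act q v](iterK n) -E.
rewrite -iterD addnC iterD.
by rewrite iterK.
Qed.

Lemma laurent_act1 v : laurent_act 1 v = v.
Proof.
have -> : 1 = tV ^+ 0 * laurent_poly 1.
  by rewrite mul1r; apply: laurent_inj; rewrite /= tofrac1.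
by rewrite laurent_actE /= poly_act1.
Qed.

Lemma laurent_act_t v : laurent_act t v = s v.
Proof.
have -> : t = tV ^+ 0 * laurent_poly ('X^1) by rewrite mul1r laurent_polyXn.
by rewrite laurent_actE -[X in poly_act X]mul1r poly_actMXn /= poly_act1.
Qed.

Lemma poly_act_iterV p n v : poly_act p (iter n sV v) = iter n sV (poly_act p v).
Proof.
elim: n => //= n <-; apply: (can_inj sK).
by rewrite -poly_act_s !sVK.
Qed.

Lemma laurent_actA a b v : laurent_act a (laurent_act b v) = laurent_act (a * b) v.
Proof.
have [p [n ->]] := laurent_polyP a; have [q [m ->]] := laurent_polyP b.
have -> : tV ^+ n * laurent_poly p * (tV ^+ m * laurent_poly q)
    = tV ^+ (n + m) * laurent_poly (p * q).
  by rewrite mulrACA exprD laurent_polyM.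
by rewrite !laurent_actE poly_act_iterV poly_actM iterD.
Qed.

Lemma laurent_actDr a : {morph laurent_act a : u v / u + v}.
Proof.
have [p [n ->]] := laurent_polyP a => u v.
by rewrite !laurent_actE poly_actDr iterV_additive.
Qed.

Lemma laurent_actDl v : {morph laurent_act^~ v : a b / a + b}.
Proof.
move=> a b; have [p [n ->]] := laurent_polyP a; have [q [m ->]] := laurent_polyP b.
have -> : tV ^+ n * laurent_poly p + tV ^+ m * laurent_poly q
    = tV ^+ (n + m) * laurent_poly (p * 'X^m + q * 'X^n).
  rewrite laurent_polyD !laurent_polyM !laurent_polyXn exprD mulrDr.
  rewrite mulrACA [tV ^+ m * t ^+ m]mulrC laurent_tXK mulr1; congr (_ + _).
  by rewrite [tV ^+ n * tV ^+ m]mulrC mulrACA [tV ^+ n * t ^+ n]mulrC laurent_tXK mulr1.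
rewrite !laurent_actE poly_actDl !poly_actMXn iterV_additive.
by rewrite {2}addnC !iterD !iterK.
Qed.

(** The phantom arguments record the invertibility of s in the type, so that a module structure
    depending on these proofs can be attached to it. *)
Definition laurent_module of cancel s sV & cancel sV s : Type := V.

HB.instance Definition _ := GRing.Zmodule.on (laurent_module sK sVK).
HB.instance Definition _ :=
  GRing.Zmodule_isLmodule.Build laurent (laurent_module sK sVK)
    laurent_actA laurent_act1 laurent_actDr laurent_actDl.

End LaurentAction.

(** * The displacement group and its abelian structure *)

Section Displacements.
Variable Q : algebra2.
Hypotheses (quandleQ : quandle Q) (medialQ : medial Q).
Implicit Types (x y z e : Q) (f g : Q -> Q).

Let mulxx x : x ** x = x. Proof. by case: quandleQ. Qed.
Let mulDl x y z : x ** (y ** z) = (x ** y) ** (x ** z).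
Proof. by case: quandleQ. Qed.
Let mulK x y : x \\ (x ** y) = y. Proof. by case: quandleQ. Qed.
Let divK x y : x ** (x \\ y) = y. Proof. by case: quandleQ. Qed.

Lemma ldiv_distr x y z : x ** (y \\ z) = (x ** y) \\ (x ** z).
Proof. by rewrite -[RHS](mulK (x ** y)) -{2}[z](divK y) mulDl !mulK. Qed.

Lemma ldivDl x y z : x \\ (y ** z) = (x \\ y) ** (x \\ z).
Proof. by rewrite -[RHS](mulK x) mulDl !divK. Qed.

Lemma ldiv_ldistr x y z : x \\ (y \\ z) = (x \\ y) \\ (x \\ z).
Proof. by rewrite -[RHS](mulK x) ldiv_distr !divK. Qed.

(** Words in the L_x L_y^-1. The inverse of a generator is again a generator, so these words already
    form a group ([disp_inv]). *)
Inductive disp : (Q -> Q) -> Prop :=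
| disp_id : disp id
| disp_step x y f : disp f -> disp (fun z => x ** (y \\ f z)).

Lemma disp_mul x y : disp (fun z => x ** (y \\ z)).
Proof. exact: disp_step disp_id. Qed.

Lemma disp_comp f g : disp f -> disp g -> disp (f \o g).
Proof. by elim=> // x y h _ IHh dg; apply: disp_step (IHh dg). Qed.

(** Mediality in operator form: after applying L_y, the two sides are (y x)(u z) and (y u)(x z).
    Commutativity of displacements follows from it. *)
Lemma mul_ldiv_swap x y u z : x ** (y \\ (u ** z)) = u ** (y \\ (x ** z)).
Proof.
have [med _ _] := medialQ.
by rewrite -[LHS](mulK y) -[RHS](mulK y) (mulDl y x) (mulDl y u) !divK med.
Qed.

Lemma ldiv_mul_swap x y v z : x \\ (y ** (v \\ z)) = v \\ (y ** (x \\ z)).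
Proof. by rewrite -[LHS](mulK v) mul_ldiv_swap divK. Qed.

Lemma disp_mulC x y u v z :
  x ** (y \\ (u ** (v \\ z))) = u ** (v \\ (x ** (y \\ z))).
Proof. by rewrite ldiv_mul_swap mul_ldiv_swap. Qed.

Lemma disp_commute f g z : disp f -> disp g -> f (g z) = g (f z).
Proof.
move=> df; elim: df g z => // x y {}f _ IHf g z dg; rewrite IHf //.
by elim: dg => // u v h _ IHh; rewrite disp_mulC IHh.
Qed.

Lemma disp_inv f : disp f -> exists2 g, disp g & cancel f g /\ cancel g f.
Proof.
elim=> [|x y h _ [g dg [hK gK]]]; first by exists id; [exact: disp_id|].
exists (fun z => g (y ** (x \\ z))).
  exact: disp_comp dg (disp_mul y x).
by split=> z; rewrite ?gK ?mulK ?divK ?mulK ?hK.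
Qed.

Lemma disp_conj e f : disp f -> disp (fun z => e ** f (e \\ z)).
Proof.
elim=> [|x y h _ IHh].
  by under [X in disp X]funext => z do rewrite divK; apply: disp_id.
under [X in disp X]funext => z do rewrite mulDl ldiv_distr.
exact: disp_step IHh.
Qed.

Lemma disp_conjV e f : disp f -> disp (fun z => e \\ f (e ** z)).
Proof.
elim=> [|x y h _ IHh].
  by under [X in disp X]funext => z do rewrite mulK; apply: disp_id.
under [X in disp X]funext => z do rewrite ldivDl ldiv_ldistr.
exact: disp_step IHh.
Qed.

(** Conjugations by L_e and L_e' differ by conjugation by the displacement L_e L_e'^-1, which is
    trivial in an abelian group. *)
Lemma disp_conj_indep e e' f z : disp f -> e ** f (e \\ z) = e' ** f (e' \\ z).
Proof.
move=> df; have := disp_commute (e' ** (e \\ z)) (disp_mul e e') (disp_conj e' df).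
by rewrite !mulK divK.
Qed.

Lemma disp_morph f : disp f -> {morph f : x y / x ** y}.
Proof. by elim=> // x y h _ IHh u v; rewrite IHh ldivDl mulDl. Qed.

(** By idempotence u z = (L_u L_z^-1) z, so at each point a left translation agrees with a
    displacement depending on that point. *)
Lemma disp_orbit x y : same_orbit x y -> exists2 f, disp f & f x = y.
Proof.
suff H f : lmlt_group f -> forall z, exists2 g, disp g & g z = f z.
  by case=> f /H /(_ x) [g dg <-] <-; exists g.
elim=> [u z|z|{}f g _ IHf _ IHg z|{}f g _ IHf _ gK z].
- by exists (fun w => u ** (z \\ w)); [exact: disp_mul|rewrite -{2}[z]mulxx mulK].
- by exists id => //; apply: disp_id.
- have [g' dg' Eg] := IHg z; have [f' df' Ef] := IHf (g z).
  by exists (f' \o g'); [exact: disp_comp|rewrite /= Eg Ef].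
- have [f' df' E] := IHf (g z); have [g' dg' [f'K _]] := disp_inv df'.
  by exists g' => //; rewrite -[z in LHS]gK -E f'K.
Qed.

Definition disp_group := {f | disp f}.

HB.instance Definition _ := gen_eqMixin disp_group.
HB.instance Definition _ := gen_choiceMixin disp_group.

Implicit Types (d : disp_group).

Lemma disp_group_inj d d' : (forall x, sval d x = sval d' x) -> d = d'.
Proof.
case: d d' => [f df] [g dg] /= E; have fg : f = g by apply/funext.
by rewrite -fg in dg *; congr exist; apply: Prop_irrelevance.
Qed.

Definition disp_add d d' : disp_group :=
  exist _ (sval d \o sval d') (disp_comp (svalP d) (svalP d')).
Definition disp_zero : disp_group := exist _ id disp_id.
Definition disp_opp d : disp_group :=
  let: exist2 g dg _ := cid2 (disp_inv (svalP d)) in exist _ g dg.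

Lemma disp_addA : associative disp_add.
Proof. by move=> d1 d2 d3; apply: disp_group_inj. Qed.
Lemma disp_addC : commutative disp_add.
Proof.
by move=> d d'; apply: disp_group_inj => x /=; apply: disp_commute; apply: svalP.
Qed.
Lemma disp_add0 : left_id disp_zero disp_add.
Proof. by move=> d; apply: disp_group_inj. Qed.
Lemma disp_addN : left_inverse disp_zero disp_opp disp_add.
Proof.
move=> d; apply: disp_group_inj => x; rewrite /disp_opp.
by case: cid2 => g dg [fK gK] /=.
Qed.

HB.instance Definition _ :=
  GRing.isZmodule.Build disp_group disp_addA disp_addC disp_add0 disp_addN.

Variable e : Q.

(* Conjugation by L_e; by disp_conj_indep it does not depend on e. *)
Definition disp_t d : disp_group := exist _ _ (disp_conj e (svalP d)).
Definition disp_tV d : disp_group := exist _ _ (disp_conjV e (svalP d)).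

Lemma disp_tK : cancel disp_t disp_tV.
Proof. by move=> d; apply: disp_group_inj => x /=; rewrite !mulK. Qed.
Lemma disp_tVK : cancel disp_tV disp_t.
Proof. by move=> d; apply: disp_group_inj => x /=; rewrite !divK. Qed.

Lemma disp_t_additive : zmod_morphism disp_t.
Proof.
have tD d d' : disp_t (d + d') = disp_t d + disp_t d'.
  by apply: disp_group_inj => x /=; rewrite mulK.
move=> d d'; apply: (addIr (disp_t d')).
by rewrite -tD !subrK.
Qed.
HB.instance Definition _ :=
  GRing.isZmodMorphism.Build disp_group disp_group disp_t disp_t_additive.
HB.instance Definition _ :=
  GRing.isZmodMorphism.Build disp_group disp_group disp_tV
    (can2_zmod_morphism disp_tK disp_tVK).

Definition disp_module : lmodType laurent := laurent_module disp_tK disp_tVK.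
End Displacements.

(** * A medial quandle acted on by its displacement module *)

Section Converse.
Variable Q : algebra2.
Hypotheses (quandleQ : quandle Q) (medialQ : medial Q).
Variable e0 : Q.
Local Notation A := (disp_module quandleQ medialQ e0).
Implicit Types (x y z e o : Q) (d k : A) (N : set A) (R : Q -> Q -> Prop).

Let mulxx x : x ** x = x. Proof. by case: quandleQ. Qed.
Let mulK x y : x \\ (x ** y) = y. Proof. by case: quandleQ. Qed.
Let divK x y : x ** (x \\ y) = y. Proof. by case: quandleQ. Qed.

Lemma mul_inj x : injective (qmul x).
Proof. exact: can_inj (mulK x). Qed.

Definition dact d : Q -> Q := sval d.

Lemma dact_inj d k : (forall x, dact d x = dact k x) -> d = k.
Proof. exact: disp_group_inj. Qed.

Lemma dactD d k x : dact (d + k) x = dact d (dact k x). Proof. by []. Qed.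

Lemma dactC d k x : dact d (dact k x) = dact k (dact d x).
Proof. by rewrite -!dactD addrC. Qed.

Lemma dactK d : cancel (dact d) (dact (- d)).
Proof. by move=> x; rewrite -dactD addNr. Qed.

Lemma dactNK d : cancel (dact (- d)) (dact d).
Proof. by move=> x; rewrite -dactD subrr. Qed.

Lemma dact_morph d : {morph dact d : x y / x ** y}.
Proof. exact: disp_morph (svalP d). Qed.

Lemma dact_t d x y : x ** dact d y = dact (t *: d) (x ** y).
Proof.
have -> : t *: d = disp_t quandleQ e0 d.
  exact: (laurent_act_t (disp_tK quandleQ e0) (d : disp_group Q)).
rewrite /dact /=.
by rewrite (disp_conj_indep quandleQ medialQ e0 x _ (svalP d)) mulK.
Qed.

Definition transv x y : A := exist _ _ (disp_mul x y).

Lemma dact_transv x y z : dact (transv x y) (y ** z) = x ** z.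
Proof. by rewrite /dact /= mulK. Qed.

Lemma disp_module_ind N : N 0 -> (forall a b, N a -> N b -> N (a + b)) ->
  (forall x y, N (transv x y)) -> forall d, N d.
Proof.
move=> N0 ND Ntransv d; have : disp (dact d) := svalP d.
move: {-2}(dact d) (erefl (dact d)) => f + df; elim: df d => [|x y g dg Ng] d dE.
  by have -> : d = 0 by apply: dact_inj => x; rewrite -dE.
have -> : d = transv x y + exist _ g dg by apply: dact_inj => z; rewrite -dE.
exact/ND/Ng.
Qed.

(** Since d is an automorphism, d L_x d^-1 = L_(d x); multiplying by L_x^-1 on the right gives d
    (L_x d L_x^-1)^-1, that is d - t d in additive notation. *)
Lemma phi_transv d x : phi d = transv (dact d x) x.
Proof.
apply: dact_inj => z; rewrite -[z](divK x) dact_transv phiE dactD -scalerN -dact_t.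
by rewrite dact_morph dactNK.
Qed.

Lemma dact_ker d x y : phi d = 0 -> dact d x ** y = x ** y.
Proof. by move=> d0; rewrite -(dact_transv (dact d x) x) -phi_transv d0. Qed.

Lemma ker_dactI d x : (forall y, dact d x ** y = x ** y) -> phi d = 0.
Proof.
move=> E; rewrite (phi_transv d x); apply: dact_inj => z.
by rewrite -[z](divK x) dact_transv E.
Qed.

Lemma transvB x y z : transv x y = transv x z - transv y z.
Proof.
apply: (addIr (transv y z)); rewrite subrK; apply: dact_inj => w.
by rewrite -[w](divK z) dactD !dact_transv.
Qed.

Lemma mul_transv x y z : x ** y = dact (transv x z - transv y z) y.
Proof. by rewrite -transvB -[LHS](dact_transv x y) mulxx. Qed.

Lemma transv_dact d x z : transv (dact d x) z = transv x z + phi d.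
Proof. by rewrite (phi_transv d x) [RHS]addrC (transvB (dact d x) x z) subrK. Qed.

Lemma transv_inj x y z : transv x z = transv y z -> forall w, x ** w = y ** w.
Proof.
by move=> E w; rewrite -(dact_transv x z) -(dact_transv y z) E.
Qed.

(** * Orbits and the three families of congruences *)

Definition orb o x := exists d, x = dact d o.

Lemma orb_refl x : orb x x.
Proof. by exists 0. Qed.

Lemma orb_dact o d x : orb o (dact d x) <-> orb o x.
Proof.
split=> [[k E]|[k ->]]; last by exists (d + k).
by exists (- d + k); rewrite dactD -E dactK.
Qed.

Lemma orb_mul o x y : orb o (x ** y) <-> orb o y.
Proof. by rewrite (mul_transv x y x) orb_dact. Qed.

Lemma orb_ldiv o x y : orb o (x \\ y) <-> orb o y.
Proof. by rewrite -{2}[y](divK x) orb_mul. Qed.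

Lemma orb_stab o d x : dact d o = o -> orb o x -> dact d x = x.
Proof. by move=> E [k ->]; rewrite dactC E. Qed.

Lemma submodule_congruence N : submodule N ->
  congruence (fun x y => exists2 d, N d & y = dact d x).
Proof.
move=> /submoduleP [N0 ND NN NZ]; split.
- by move=> x; exists 0.
- by move=> x y [d Nd ->]; exists (- d); [exact: NN|rewrite dactK].
- by move=> x y z [d Nd ->] [k Nk ->]; exists (k + d); [exact: ND|].
- move=> x y u v [d Nd ->] [k Nk ->].
  (* (d x)(k u) = d (x ((k - d) u)), and moving k - d out past L_x multiplies it by t. *)
  exists (d + t *: (- d + k)); first exact/(ND _ _ Nd)/NZ/(ND _ _ (NN _ Nd)).
  by rewrite dactD -dact_t dact_morph -dactD addrA subrr add0r.
- move=> x y u v [d Nd ->] [k Nk ->].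
  exists (d + tV *: (- d + k)); first exact/(ND _ _ Nd)/NZ/(ND _ _ (NN _ Nd)).
  apply: (@mul_inj (dact d x)); rewrite divK dactD -dact_morph dact_t laurent_scaleVK divK.
  by rewrite -dactD addrA subrr add0r.
Qed.

Lemma orbit_ker_congruence o :
  congruence (fun x y => x = y \/ orb o x /\ exists2 d, phi d = 0 & y = dact d x).
Proof.
set R := fun x y => _; have RL x y z : R x y -> y ** z = x ** z.
  by case=> [->//|[_ [d d0 ->]]]; apply: dact_ker.
split=> [x|x y|x y z|x y u v|x y u v].
- by left.
- move=> [->|[ox [d d0 ->]]]; first by left.
  right; split; first exact/orb_dact.
  by exists (- d); rewrite ?phiN ?d0 ?oppr0 // dactK.
- move=> [->//|[ox [d d0 ->]]] [<-|[_ [k k0 ->]]]; right; split=> //; first by exists d.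
  by exists (k + d); rewrite // phiD d0 k0 addr0.
- move=> /RL Lxy; rewrite /R Lxy => -[->|[ou [d d0 ->]]]; first by left.
  right; split; first exact/orb_mul.
  by exists (t *: d); rewrite ?phi_scale ?d0 ?scaler0 // dact_t.
- move=> /RL Lxy; have -> : y \\ v = x \\ v by apply: (@mul_inj x); rewrite -Lxy !divK.
  rewrite /R => -[->|[ou [d d0 ->]]]; first by left.
  right; split; first exact/orb_ldiv.
  exists (tV *: d); first by rewrite phi_scale d0 scaler0.
  by apply: (@mul_inj x); rewrite dact_t laurent_scaleVK !divK.
Qed.

(** Compatibility holds because L_(x u) = L_x L_u L_x^-1 is determined by L_x and L_u, while
    products and quotients stay in the orbit of their right argument. *)
Lemma off_orbit_congruence o :
  congruence (fun x y => x = y \/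
    [/\ ~ orb o x, ~ orb o y & forall z, x ** z = y ** z]).
Proof.
set R := fun x y => _; have RL x y z : R x y -> y ** z = x ** z.
  by case=> [->//|[_ _ ->]].
split=> [x|x y|x y z|x y u v|x y u v].
- by left.
- by move=> [->|[ox oy E]]; [left|right; split=> // z; rewrite E].
- move=> [->//|[ox oy E]] [<-|[_ oz E']]; right; split=> // w.
  by rewrite E.
- move=> /RL Lxy; rewrite /R Lxy => -[->|[ou ov E]]; first by left.
  right; split; rewrite ?orb_mul // => z.
  case: quandleQ => _ distr _ _.
  by rewrite -[z](divK x) -!(distr x) E.
- move=> /RL Lxy; have -> : y \\ v = x \\ v by apply: (@mul_inj x); rewrite -Lxy !divK.
  rewrite /R => -[->|[ou ov E]]; first by left.
  right; split; rewrite ?orb_ldiv // => z.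
  apply: (@mul_inj x); case: quandleQ => _ distr _ _.
  by rewrite !(distr x) !divK E.
Qed.

Lemma congruence_neq R x y : congruence R -> R x y -> x <> y -> nontrivial_congruence R.
Proof. by move=> cR Rxy xy; split=> // E; rewrite E in Rxy. Qed.

(** * Consequences of subdirect irreducibility *)

Lemma monolith_pair : subdirectly_irreducible Q ->
  exists x y, x <> y /\ forall R, nontrivial_congruence R -> R x y.
Proof.
move=> SI; apply: contra_notP SI => noxy; apply/funext => x; apply/funext => y.
apply/propext; split=> [H|<- R [[Rr _ _ _ _] _] //].
by apply: contra_notP noxy => xy; exists x, y.
Qed.

Variables (e : Q) (x0 y0 : Q) (k0 : A).
Hypotheses (phik0 : phi k0 = 0) (k0e : dact k0 e <> e) (xy0 : x0 <> y0).
Hypothesis monolith : forall R, nontrivial_congruence R -> R x0 y0.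

Lemma monolith_orbit o k : phi k = 0 -> dact k o <> o -> 
  orb o x0 /\ exists2 m, phi m = 0 & y0 = dact m x0.
Proof.
move=> phik ko; suff /monolith [//|] : nontrivial_congruence
  (fun x y => x = y \/ orb o x /\ exists2 d, phi d = 0 & y = dact d x) by [].
apply: (congruence_neq (orbit_ker_congruence o) (x := o) (y := dact k o)); last exact/nesym.
by right; split; [exact: orb_refl|exists k].
Qed.

(** Two orbits moved by ker phi would both contain [x0]. *)
Lemma ker_fix x k : ~ orb e x -> phi k = 0 -> dact k x = x.
Proof.
move=> ex phik; apply: contra_notP ex => kx.
have [[d x0d] _] := monolith_orbit phik kx; have [[d' E] _] := monolith_orbit phik0 k0e.
by exists (- d + d'); rewrite dactD -E x0d dactK.
Qed.

(** If d fixes e, then d lies in ker phi. It fixes the orbit of e by commutativity and all other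
    points by [ker_fix]. *)
Lemma stab_e d : dact d e = e -> d = 0.
Proof.
move=> de; have phid : phi d = 0 by apply: (@ker_dactI _ e) => y; rewrite de.
apply: dact_inj => x; have [ex|ex] := pselect (orb e x); first exact: orb_stab de ex.
exact: ker_fix.
Qed.

Lemma dact_orb_inj d k x : orb e x -> dact d x = dact k x -> d = k.
Proof.
move=> [a ->] E; apply/eqP; rewrite -subr_eq0; apply/eqP/stab_e.
by apply: (can_inj (dactK a)); rewrite dactC [d - k]addrC dactD E dactK.
Qed.

(** Otherwise the congruence of equal L off the orbit of e would be non-trivial and relate [x0] to
    [y0], although [x0] lies in that orbit. *)
Lemma transv_off_inj x y z : ~ orb e x -> ~ orb e y -> transv x z = transv y z -> x = y.
Proof.
move=> ex ey E; apply: contrapT => xy.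
have [//|] := monolith (congruence_neq (off_orbit_congruence e)
  (or_intror (And3 ex ey (transv_inj E))) xy).
by case: (monolith_orbit phik0 k0e) => ? _ [].
Qed.

Lemma disp_module_subdirectly_irreducible : module_subdirectly_irreducible A.
Proof.
have [ex0 [m _ y0E]] := monolith_orbit phik0 k0e.
have m0 : m <> 0 by move=> E; apply: xy0; rewrite y0E E.
exists [set d | forall N, submodule N -> N <> [set 0] -> N d]; split.
- apply: submoduleI => [N /submoduleP[]|d k Nd Nk N sN N0|d Nd N sN N0|
    d Nd N sN N0|d Nd N sN N0] //; have [_ ND NN NZ] := submoduleP sN.
  + by apply: ND; [exact: Nd|exact: Nk].
  + exact: NN (Nd _ sN N0).
  + exact: NZ (Nd _ sN N0).
  + exact: NZ (Nd _ sN N0).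
- move=> E; have : [set 0] m; last by [].
  rewrite -E => N sN N0; have [N_0 _ _ _] := submoduleP sN.
  have [n Nn n0] : exists2 n, N n & n <> 0.
    apply: contra_notP N0 => noN; apply/seteqP; split=> [a Na|_ -> //].
    by apply: contra_notP noN => a0; exists a.
  have [x nx] : exists x, x <> dact n x.
    by apply: contra_notP n0 => nox; apply: dact_inj => x; apply: contrapT => nx;
      apply: nox; exists x; apply/nesym.
  (* The congruence of N gives d in N with y0 = d x0; since also y0 = m x0, regularity yields d =
     m. *)
  have [d Nd] := monolith (congruence_neq (submodule_congruence sN)
    (ex_intro2 _ _ n Nn erefl) nx).
  by rewrite y0E => /(dact_orb_inj ex0) ->.
- by move=> N sN N0 d; apply.
Qed.

(** * Coset representatives off the moved orbit *)

Local Notation imphi := (range (@phi A)).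

Definition coset_repr d : A := xget 0 [set c | imphi (c - d)].

Lemma coset_reprP d : imphi (coset_repr d - d).
Proof.
by apply: (@xgetPex _ 0 [set c | imphi (c - d)]); exists d; exists 0; rewrite ?subrr ?phi0.
Qed.

(** The set passed to [xget] is the coset itself, so elements of one coset receive the same
    representative. *)
Lemma coset_repr_eq d k : imphi (d - k) -> coset_repr d = coset_repr k.
Proof.
case=> a _ E; congr (xget 0 _); apply/seteqP; split=> c [b _ Ec] /=.
  by exists (b + a) => //; rewrite phiD E Ec addrA subrK.
by exists (b - a) => //; rewrite phiB E Ec opprB addrA subrK.
Qed.

Definition off_repr : set A := [set c | exists2 x, ~ orb e x & c = coset_repr (transv x e)].

Lemma off_repr_transversal : sub_transversal imphi off_repr.
Proof.
exists (range coset_repr) => [d|c [x _ ->]]; last by exists (transv x e).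
exists (coset_repr d); split; first by split; [exists d|exact: coset_reprP].
move=> _ [[c _ <-] Icd]; apply: coset_repr_eq.
case: Icd => a _ Ea; case: (coset_reprP c) => b _ Eb; exists (b - a) => //.
by rewrite phiB Ea Eb opprB addrC addrA subrK.
Qed.

(** Each L_x L_e^-1 is phi d if x = d e, and otherwise a representative plus an element of phi(A);
    their differences generate all displacements. *)
Lemma off_repr_generates : generates_module (off_repr `|` imphi).
Proof.
apply/seteqP; split=> // a _ N [sN GN]; have [N0 ND NN NZ] := submoduleP sN.
have Ntransv x : N (transv x e).
  have [[d ->]|ex] := pselect (orb e x).
    by rewrite -phi_transv; apply: GN; right; exists d.
  rewrite -[transv x e]subr0 -(subrr (coset_repr (transv x e))) opprB addrCA.
  apply: ND; first by apply: GN; left; exists x.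
  by rewrite -opprB; apply/NN/GN; right; apply: coset_reprP.
apply: disp_module_ind => // x y.
by rewrite (transvB x y e); apply: ND => //; apply: NN.
Qed.

(** * The isomorphism onto SIQ *)

Lemma off_part_subproof x : transv x e - coset_repr (transv x e) \in imphi.
Proof.
apply/mem_set; rewrite -opprB; case: (coset_reprP (transv x e)) => a _ <-.
by exists (- a); rewrite ?phiN.
Qed.

Lemma off_repr_subproof x : ~ orb e x -> coset_repr (transv x e) \in off_repr.
Proof. by move=> ex; apply/mem_set; exists x. Qed.

(** The second case splits the value L_x L_e^-1 into its part in phi(A) and its coset
    representative, so that [siq_val] recovers it. *)
Definition to_siq x : SIQ off_repr :=
  match pselect (orb e x) with
  | left ex => inl (projT1 (cid ex))
  | right ex => inr (exist (fun d : A => d \in imphi) _ (off_part_subproof x),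
                     exist (fun d : A => d \in off_repr) _ (off_repr_subproof ex))
  end.

Lemma to_siq_dact d : to_siq (dact d e) = inl d.
Proof.
rewrite /to_siq; case: pselect => [ex|]; last by case; exists d.
by case: cid => k /= /(dact_orb_inj (orb_refl e)) ->.
Qed.

Lemma siq_val_to_siq x : siq_val (to_siq x) = transv x e.
Proof.
rewrite /to_siq; case: pselect => [ex|ex] /=; last by rewrite subrK.
by case: cid => k /= ->; rewrite (phi_transv k e).
Qed.

Lemma to_siq_shift d x : to_siq (dact d x) = siq_shift d (to_siq x).
Proof.
have [[k ->]|ex] := pselect (orb e x).
  by rewrite -dactD !to_siq_dact /= addrC.
rewrite /to_siq; case: pselect => [/orb_dact //|exd]; case: pselect => // ex'.
have rE : coset_repr (transv (dact d x) e) = coset_repr (transv x e).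
  by apply: coset_repr_eq; rewrite transv_dact addrC addKr; exists d.
by congr (inr (_, _)); apply: val_inj => //=; rewrite rE transv_dact addrAC.
Qed.

Lemma to_siq_mul x y : to_siq (x ** y) = to_siq x ** to_siq y.
Proof. by rewrite siq_mulE !siq_val_to_siq -to_siq_shift -mul_transv. Qed.

Lemma to_siq_ldiv x y : to_siq (x \\ y) = to_siq x \\ to_siq y.
Proof.
by apply: (@siq_mul_inj _ _ (to_siq x)); rewrite siq_divP -to_siq_mul divK.
Qed.

Lemma to_siq_inj : injective to_siq.
Proof.
move=> x y E; have vE : transv x e = transv y e by rewrite -!siq_val_to_siq E.
move: E; have [[d ->]|ex] := pselect (orb e x).
  have [[k ->]|ey] := pselect (orb e y); first by rewrite !to_siq_dact => -[->].
  by rewrite to_siq_dact /to_siq; case: pselect.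
rewrite /to_siq; case: pselect => // ex'; case: pselect => // ey _.
exact: transv_off_inj vE.
Qed.

Lemma to_siq_surj (z : SIQ off_repr) : exists x, to_siq x = z.
Proof.
case: z => [d|[b j]]; first by exists (dact d e); apply: to_siq_dact.
have [x ex jE] := set_mem (valP j).
(* x only has its value in the right coset; translating it by d corrects the value by phi d. *)
have [d _ dE] : imphi (val b + val j - transv x e).
  have [a _ <-] := set_mem (valP b); have [c _ cE] := coset_reprP (transv x e).
  by exists (a + c); rewrite // phiD cE jE addrA.
exists (dact d x); have transvE : transv (dact d x) e = val b + val j.
  by rewrite transv_dact dE addrC subrK.
have rE : coset_repr (transv (dact d x) e) = val j.
  by rewrite jE; apply: coset_repr_eq; rewrite transv_dact addrC addKr; exists d.
rewrite /to_siq; case: pselect => [/orb_dact //|exd].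
by congr (inr (_, _)); apply: val_inj => //=; rewrite rE transvE addrK.
Qed.

Lemma to_siq_isomorphic : isomorphic Q (SIQ off_repr).
Proof.
exists to_siq; split; [|exact: to_siq_mul|exact: to_siq_ldiv].
pose g (z : SIQ off_repr) := projT1 (cid (to_siq_surj z)).
have gK : cancel g to_siq by move=> z; rewrite /g; case: cid.
by exists g => // x; apply: to_siq_inj; rewrite gK.
Qed.

End Converse.

Theorem theorem7p10 :
  (forall (A : lmodType laurent) (C : set A),
     module_subdirectly_irreducible A ->
     ~ injective (@phi A) ->
     sub_transversal (range (@phi A)) C ->
     generates_module (C `|` range (@phi A)) ->
     [/\ quandle (SIQ C), medial (SIQ C), quasi_reductive (SIQ C)
       & subdirectly_irreducible (SIQ C)])
  /\
  (forall Q : algebra2,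
     quandle Q -> medial Q -> quasi_reductive Q -> subdirectly_irreducible Q ->
     exists (A : lmodType laurent) (C : set A),
       [/\ module_subdirectly_irreducible A,
           ~ injective (@phi A),
           sub_transversal (range (@phi A)) C,
           generates_module (C `|` range (@phi A))
         & isomorphic Q (SIQ C)]).
Proof.
split=> [A C Asi ninj Csub gen|Q qQ mQ [e [e' [ee' oee' LE]]] /monolith_pair].
  split; [exact: siq_quandle|exact: siq_medial| |].
    exact: siq_quasi_reductive.
  exact: siq_subdirectly_irreducible.
move=> [x0 [y0 [xy0 mono]]].
(* The quasi-reductive pair is e, k e for a displacement k; L_e = L_(k e) puts k into ker phi, while
   k moves e. *)
have [f df fe] := disp_orbit qQ oee'.
pose k : disp_module qQ mQ e := exist _ f df.
have ke : dact k e <> e by rewrite /dact /= fe; apply/nesym.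
have phik : phi k = 0.
  by apply: (@ker_dactI _ _ _ _ _ e) => y; rewrite /dact /= fe -[e' ** y]/(ltrans e' y) -LE.
exists (disp_module qQ mQ e), (@off_repr Q qQ mQ e e); split.
- exact: (disp_module_subdirectly_irreducible phik ke xy0 mono).
- by move=> inj; apply: ke; rewrite (inj k 0) // phik phi0.
- exact: off_repr_transversal.
- exact: off_repr_generates.
- exact: (to_siq_isomorphic phik ke xy0 mono).
Qed.
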